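(* Let $pod_2(n)$ be defined by $\sum_{n\ge 0} pod_2(n)q^n = \frac{\psi(-q^2)}{\psi(-q)} = \frac{f_2^2 f_8}{f_1 f_4^2}$. Then: (i) for every positive integer $n$, $pod_2(3n+2)\equiv 0 \pmod 2$; (ii) $\sum_{n=0}^{\infty} pod_2(3n)\,q^n \equiv f_1 \pmod 2$; (iii) $\sum_{n=0}^{\infty} pod_2(9n+1)\,q^n \equiv f_1^3 \pmod 2$.
   Context: For $|q|<1$ and integers $j\ge 1$, $f_j := \prod_{n=1}^{\infty}(1-q^{jn})$. Ramanujan's theta function is $\psi(q) := \sum_{n=0}^{\infty} q^{n(n+1)/2} = f_2^2/f_1$, so that $\psi(-q) = f_1f_4/f_2$. The paper describes $pod_2(n)$ as the number of $2$-regular partitions of $n$ with distinct odd parts (even parts unrestricted), with generating function $\sum_{n\ge0} pod_2(n)q^n = \psi(-q^2)/\psi(-q)$. A congruence between power series in $q$ with integer coefficients modulo $m$ means coefficientwise congruence modulo $m$. *)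

(* Defs.v *)
From HB Require Import structures.
From mathcomp Require Import all_boot all_order all_algebra.

Set Implicit Arguments.
Unset Strict Implicit.
Unset Printing Implicit Defensive.

Import GRing.Theory.
Local Open Scope ring_scope.

(* A formal power series over the integers is its sequence of coefficients.   *)
Definition fps := nat -> int.

Definition fps_one : fps := fun n => (n == 0%N)%:R.

Definition fps_mul (a b : fps) : fps :=
  fun n => \sum_(i < n.+1) a i * b (n - i)%N.

Definition fps_exp (a : fps) (k : nat) : fps := iter k (fps_mul a) fps_one.

(* Long division: c = a / b has c_n = (a_n - \sum_(i < n) c_i b_(n-i)) / b_0. *)
(* It is meaningful when b_0 is invertible, i.e., 1 or -1; see fps_divK.      *)
Fixpoint fps_div_prefix (a b : fps) (n : nat) : seq int :=
  if n is m.+1 then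
    let s := fps_div_prefix a b m in
    rcons s ((a m - \sum_(i < m) s`_i * b (m - i)%N) / b 0%N)
  else [::].

Definition fps_div (a b : fps) : fps := fun n => (fps_div_prefix a b n.+1)`_n.

(* The series a(c q^k), for k >= 1.                                           *)
Definition fps_subst (a : fps) (c : int) (k : nat) : fps :=
  fun n => if (k %| n)%N then c ^+ (n %/ k)%N * a (n %/ k)%N else 0.

Definition fps_eqmod (m : int) (a b : fps) : Prop :=
  forall n, (a n = b n %[mod m])%Z.

Declare Scope fps_scope.
Delimit Scope fps_scope with fps.
Bind Scope fps_scope with fps.
Notation "a * b" := (fps_mul a b) : fps_scope.
Notation "a / b" := (fps_div a b) : fps_scope.
Notation "a ^+ k" := (fps_exp a k) : fps_scope.

(* f_j = \prod_(k >= 1) (1 - q^(j k)), for j >= 1. The factors with k > n do  *)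
(* not affect the coefficient of q^n; see euler_f_stable.                     *)
Definition euler_f (j : nat) : fps :=
  fun n => (\prod_(1 <= k < n.+1) (1 - 'X^(j * k)) : {poly int})`_n.

(* \sum_(k >= 0) q^(k (k + 1) / 2): k <= k (k + 1) / 2, so only k <= n can    *)
(* contribute to the coefficient of q^n.                                      *)
Definition psi : fps :=
  fun n => \sum_(k < n.+1) ((k * k.+1)./2 == n)%:R.

Definition pod2 : fps := (fps_subst psi (-1) 2 / fps_subst psi (-1) 1)%fps.

Lemma size_fps_div_prefix a b n : size (fps_div_prefix a b n) = n.
Proof. by elim: n => //= n IHn; rewrite size_rcons IHn. Qed.

Lemma nth_fps_div_prefix a b n i :
  (i < n)%N -> (fps_div_prefix a b n)`_i = fps_div a b i.
Proof.
elim: n => // n IHn; rewrite ltnS leq_eqVlt => /orP[/eqP-> // | lt_in].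
by rewrite /= nth_rcons size_fps_div_prefix lt_in IHn.
Qed.

Lemma fps_divK a b : b 0%N \is a GRing.unit -> (a / b * b)%fps =1 a.
Proof.
move=> Ub n; rewrite /fps_mul big_ord_recr /= subnn.
rewrite {2}/fps_div /= nth_rcons size_fps_div_prefix ltnn eqxx divrK //.
rewrite addrC -[RHS]addr0 -addrA; congr (_ + _); rewrite addrC.
apply/eqP; rewrite subr_eq0; apply/eqP; apply: eq_bigr => i _.
by rewrite nth_fps_div_prefix.
Qed.

Lemma euler_f_stable j n N : (0 < j)%N -> (n <= N)%N ->
  (\prod_(1 <= k < N.+1) (1 - 'X^(j * k)) : {poly int})`_n = euler_f j n.
Proof.
move=> j_gt0; elim: N => [|N IHN]; first by rewrite leqn0 => /eqP->.
rewrite leq_eqVlt => /orP[/eqP-> // | lt_nN].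
rewrite big_nat_recr //= mulrBr mulr1 coefB coefMXn IHN //.
by rewrite (leq_trans lt_nN (leq_pmull _ j_gt0)) subr0.
Qed.

Lemma euler_f0 j : euler_f j 0%N = 1.
Proof. by rewrite /euler_f big_geq // coef1. Qed.

Lemma psi0 : psi 0%N = 1.
Proof. by rewrite /psi big_ord1. Qed.

Lemma fps_mul0 a b : (a * b)%fps 0%N = a 0%N * b 0%N.
Proof. by rewrite /fps_mul big_ord1. Qed.

Lemma pod2_spec : (pod2 * fps_subst psi (-1) 1)%fps =1 fps_subst psi (-1) 2.
Proof. by apply: fps_divK; rewrite /fps_subst /= psi0. Qed.

Lemma eta_denominator0 : (euler_f 1 * euler_f 4 ^+ 2)%fps 0%N = 1.
Proof. by rewrite /fps_exp /= !fps_mul0 !euler_f0. Qed.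

(* Main.v *)
Require Import Defs.
From mathcomp Require Import all_boot all_order all_algebra.
From mathcomp Require Import ring zify.

(** Shanks's telescoping finite form of Gauss's identity,
    [\prod_(i < n) (1 - q^(2i+1)) * \sum_(s <= 2n) q^(s(s+1)/2)
     = \sum_(s <= n) \prod_(s < i <= n) (1 - q^(2i)) \prod_(i < s) (1 - q^(2i+1)) q^(s(2n+1))],
    is a polynomial identity whose right-hand side is [\prod_(i <= n) (1 - q^(2i))]
    modulo [q^(2n+1)]. Taken at [-q^k] it gives [psi(-q^k) f_(2k) = f_k f_(4k)],
    hence the eta quotient for [pod2]. Modulo 2, [f_(2j) = f_j^2], so both [pod2]
    and [psi] reduce to [f_1^3], and [pod2 n] is odd exactly when [n] is triangular.
    A triangular number is never 2 modulo 3, those equal to 1 modulo 3 are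
    [9 T + 1] with [T] triangular, and those divisible by 3 are three times the
    generalized pentagonal numbers, which are the exponents of [f_1] by Euler's
    pentagonal theorem (again in Shanks's finite form). *)

Set Implicit Arguments.
Unset Strict Implicit.
Unset Printing Implicit Defensive.

Import GRing.Theory.
Local Open Scope ring_scope.

(** * Triangular numbers along the residue classes modulo 3 *)

Definition tri (k : nat) : nat := (k * k.+1)./2.
Arguments tri : simpl never.

Lemma tri_double k : (tri k).*2 = (k * k.+1)%N.
Proof.
rewrite /tri; elim: k => // k IHk.
have -> : (k.+1 * k.+2 = k.+1.*2 + k * k.+1)%N by lia.
by rewrite halfD odd_double add0n doubleK doubleD IHk.
Qed.

Lemma triS k : tri k.+1 = (tri k + k.+1)%N.
Proof. by move: (tri_double k) (tri_double k.+1); lia. Qed.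

Lemma tri_odd n : tri n.*2.+1 = (n.+1 * n.*2.+1)%N.
Proof. by have := tri_double n.*2.+1; lia. Qed.

Lemma tri_3k k : tri (3 * k) = (3 * (k * k + tri k))%N.
Proof. by move: (tri_double k) (tri_double (3 * k)); lia. Qed.

Lemma tri_3k1 k : tri (3 * k + 1) = (9 * tri k + 1)%N.
Proof. by move: (tri_double k) (tri_double (3 * k + 1)); lia. Qed.

Lemma tri_3k2 k : tri (3 * k + 2) = (3 * (k * k.+1 + tri k.+1))%N.
Proof. by move: (tri_double k.+1) (tri_double (3 * k + 2)); lia. Qed.

Lemma leq_tri k : (k <= tri k)%N.
Proof. by have := tri_double k; nia. Qed.

(** * Shanks's finite identities *)

Section Shanks.

Variables (R : comPzRingType) (q : R).

Definition prod_odd n := \prod_(i < n) (1 - q ^+ i.*2.+1).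
Definition prod_even s n := \prod_(s <= i < n) (1 - q ^+ i.+1.*2).
Definition prod_all s n := \prod_(s <= i < n) (1 - q ^+ i.+1).

(** The bracket is [(1 - q^(2s+1)) q^(2n+1) - (1 - q^(2s))], so each summand with [s > 0] is the
    right-hand side at [m = s] minus that at [m = s - 1]. *)
Lemma gauss_telescope n m : (m <= n)%N ->
  \sum_(s < m.+1) prod_even s n * prod_odd s * q ^+ (s * n.*2.+1)
      * ((1 - q ^+ n.+1.*2) * q ^+ s.*2 - 1 + q ^+ n.*2.+1)
  = prod_even m n * prod_odd m.+1 * q ^+ (m.+1 * n.*2.+1).
Proof.
elim: m => [_|m IHm lt_mn].
  rewrite big_ord1 /prod_odd big_ord0 big_ord_recr big_ord0 /= doubleS mul1n !exprS.
  by ring.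
rewrite big_ord_recr /= IHm 1?ltnW // /prod_even big_ltn // -/(prod_even _ _).
rewrite /prod_odd [in RHS]big_ord_recr /= -/(prod_odd _) [in RHS]mulSn [in RHS]exprD.
set u := q ^+ (m.+1 * _); rewrite !doubleS !exprS.
by ring.
Qed.

(** From [n] to [n + 1] the old summands gain the factor [(1 - q^(2n+2)) q^(2s)], which is the
    telescoping bracket plus [1 - q^(2n+1)]; the latter is the new factor of [prod_odd]. *)
Lemma gauss_finite n :
  prod_odd n * (\sum_(s < n.*2.+1) q ^+ tri s)
  = \sum_(s < n.+1) prod_even s n * prod_odd s * q ^+ (s * n.*2.+1).
Proof.
elim: n => [|n IHn]; first by rewrite /prod_odd /prod_even !big_ord1 !big_ord0 big_geq ?mulr1.
have prod_oddS k : prod_odd k.+1 = prod_odd k * (1 - q ^+ k.*2.+1).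
  by rewrite /prod_odd big_ord_recr.
rewrite [RHS]big_ord_recr /= {2}/prod_even big_geq // mul1r.
under [X in _ = X + _]eq_bigr => s _.
  rewrite /prod_even big_nat_recr ?leq_ord //= -/(prod_even _ _).
  have -> : q ^+ (s * n.+1.*2.+1) = q ^+ (s * n.*2.+1) * q ^+ s.*2.
    by rewrite -exprD; congr (_ ^+ _); lia.
  have -> : prod_even s n * (1 - q ^+ n.+1.*2) * prod_odd s
                * (q ^+ (s * n.*2.+1) * q ^+ s.*2)
      = prod_even s n * prod_odd s * q ^+ (s * n.*2.+1)
          * ((1 - q ^+ n.+1.*2) * q ^+ s.*2 - 1 + q ^+ n.*2.+1)
        + (1 - q ^+ n.*2.+1) * (prod_even s n * prod_odd s * q ^+ (s * n.*2.+1)).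
    by ring.
  over.
rewrite big_split /= -mulr_sumr -IHn gauss_telescope // /prod_even big_geq //.
(* The telescoped sum and the summand [s = n + 1] supply the new exponents [tri (2n+1)] and
   [tri (2n+2)]. *)
rewrite doubleS 2!big_ord_recr /= [tri _.+2]triS tri_odd !prod_oddS.
have -> : (n.+1 * n.*2.+1 + n.*2.+2 = n.+1 * n.*2.+3)%N by lia.
by ring.
Qed.

(** Here the bracket is [- q^(n+s+1) - (1 - q^s)], again giving a difference of consecutive
    right-hand sides. *)
Lemma pentagonal_telescope n m : (m <= n)%N ->
  \sum_(s < m.+1) (-1) ^+ s * prod_all s n * q ^+ (n * s + tri s)
      * ((1 - q ^+ n.+1) * q ^+ s - 1)
  = (-1) ^+ m.+1 * prod_all m n * q ^+ (n * m.+1 + tri m.+1).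
Proof.
elim: m => [_|m IHm lt_mn].
  by rewrite big_ord1 /= muln0 muln1 addn1 !expr0; ring.
rewrite big_ord_recr /= IHm 1?ltnW // /prod_all big_ltn // -/(prod_all _ _).
have -> : (n * m.+2 + tri m.+2 = n * m.+1 + tri m.+1 + (n.+1 + m.+1))%N.
  by rewrite [tri m.+2]triS; lia.
rewrite [in RHS]exprD; set u := q ^+ (n * _ + _).
by rewrite exprD !exprS; ring.
Qed.

(** With [K = k + 1] the exponents are [K(3K-1)/2] and [K(3K+1)/2], the generalized pentagonal
    numbers. Each induction step adds one pair: the first from the telescoped sum, the second from
    the summand [s = n + 1]. *)
Lemma pentagonal_finite n :
  \sum_(s < n.+1) (-1) ^+ s * prod_all s n * q ^+ (n * s + tri s)
  = 1 + \sum_(k < n) (-1) ^+ k.+1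
          * (q ^+ (k * k.+1 + tri k.+1) + q ^+ (k.+1 * k.+1 + tri k.+1)).
Proof.
elim: n => [|n IHn].
  by rewrite big_ord1 big_ord0 /prod_all big_geq // !mulr1 addr0.
rewrite big_ord_recr /= {2}/prod_all big_geq // mulr1.
under eq_bigr => s _.
  rewrite /prod_all big_nat_recr ?leq_ord //= -/(prod_all _ _).
  have -> : (n.+1 * s + tri s = n * s + tri s + s)%N by lia.
  rewrite exprD.
  have -> : (-1) ^+ s * (prod_all s n * (1 - q ^+ n.+1))
                * (q ^+ (n * s + tri s) * q ^+ s)
      = (-1) ^+ s * prod_all s n * q ^+ (n * s + tri s)
          * ((1 - q ^+ n.+1) * q ^+ s - 1)
        + (-1) ^+ s * prod_all s n * q ^+ (n * s + tri s).
    by ring.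
  over.
rewrite big_split /= IHn pentagonal_telescope // /prod_all big_geq //.
by rewrite [in RHS]big_ord_recr /=; ring.
Qed.

Lemma prod_odd_even n :
  prod_odd n * \prod_(1 <= k < n.+1) (1 - q ^+ k.*2)
  = \prod_(1 <= k < n.*2.+1) (1 - q ^+ k).
Proof.
rewrite /prod_odd; elim: n => [|n IHn]; first by rewrite big_ord0 !big_geq // mulr1.
rewrite big_ord_recr big_nat_recr //= doubleS 2?[in RHS]big_nat_recr //= -IHn.
by ring.
Qed.

End Shanks.

(** * Polynomials modulo a power of the variable *)

Section Truncation.

Variable R : comNzRingType.
Implicit Types p q d : {poly R}.

(** Congruence modulo [X^N]. Power series identities are proved on polynomials up to this relation,
    where [ring] applies. *)
Definition eqX N p q := forall i, (i < N)%N -> p`_i = q`_i.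

Lemma eqX_refl N p : eqX N p p. Proof. by []. Qed.

Lemma eqX_sym N p q : eqX N p q -> eqX N q p.
Proof. by move=> e i /e. Qed.

Lemma eqX_trans N q p d : eqX N p q -> eqX N q d -> eqX N p d.
Proof. by move=> e1 e2 i lt_iN; rewrite e1 // e2. Qed.

Lemma eqXM N p p' q q' : eqX N p p' -> eqX N q q' -> eqX N (p * q) (p' * q').
Proof.
move=> ep eq i lt_iN; rewrite !coefM; apply: eq_bigr => j _.
by rewrite ep ?eq //; apply: leq_ltn_trans lt_iN; rewrite ?leq_subr // -ltnS.
Qed.

Lemma eqX_addXn N k p d : (N <= k)%N -> eqX N (p + d * 'X^k) p.
Proof.
by move=> le_Nk i lt_iN; rewrite coefD coefMXn (leq_trans lt_iN) // addr0.
Qed.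

(** A polynomial with constant coefficient 1 is invertible modulo [X^N]. *)
Lemma eqX_cancel N d p q : d`_0 = 1 -> eqX N (p * d) (q * d) -> eqX N p q.
Proof.
move=> d0 epq; elim/ltn_ind => i IHi lt_iN.
have := epq i lt_iN; rewrite !coefM !big_ord_recr /= subnn d0 !mulr1.
rewrite (eq_bigr (fun j : 'I_i => q`_j * d`_(i - j))); first exact: addrI.
by move=> j _; rewrite IHi // (ltn_trans _ lt_iN).
Qed.

Lemma eqX_prod_trunc j M N : (0 < j)%N -> (M <= N)%N ->
  eqX M.+1 (\prod_(1 <= k < N.+1) (1 - 'X^(j * k)))
           (\prod_(1 <= k < M.+1) (1 - 'X^(j * k)) : {poly R}).
Proof.
move=> j_gt0; elim: N => [|N IHN]; first by rewrite leqn0 => /eqP->.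
rewrite leq_eqVlt => /predU1P[-> // | lt_MN].
rewrite big_nat_recr //= mulrBr mulr1 -mulNr.
by apply: eqX_trans (IHN lt_MN); apply: eqX_addXn; nia.
Qed.

Definition euler_poly M j : {poly R} := \prod_(1 <= k < M.+1) (1 - 'X^(j * k)).

Lemma euler_poly_coef0 M j : (0 < j)%N -> (euler_poly M j)`_0 = 1.
Proof.
move=> j_gt0; rewrite (@eqX_prod_trunc j 0 M) //.
by rewrite big_geq // coef1.
Qed.

(** Reduces the product side of either finite identity to its term [s = 0]. *)
Lemma eqX_sum_first N m (G : nat -> {poly R}) (e : nat -> nat) :
  (forall s, (0 < s)%N -> (N <= e s)%N) ->
  eqX N (\sum_(s < m.+1) G s * 'X^(e s)) (G 0%N * 'X^(e 0%N)).
Proof.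
move=> le_N; elim: m => [|m IHm]; first by rewrite big_ord1.
by rewrite big_ord_recr /=; apply: eqX_trans IHm; apply/eqX_addXn/le_N.
Qed.

End Truncation.

(** * Coefficients of psi *)

Lemma psi_stable n N : (n < N)%N -> \sum_(k < N) (tri k == n)%:R = psi n.
Proof.
elim: N => // N IHN; rewrite ltnS leq_eqVlt => /predU1P[-> // | lt_nN].
rewrite big_ord_recr /= IHN // gtn_eqF ?addr0 //.
exact: leq_trans lt_nN (leq_tri N).
Qed.

Lemma big_ord_mod3 (V : nmodType) n (g : nat -> V) :
  \sum_(t < 3 * n) g t
  = \sum_(k < n) (g (3 * k)%N + g (3 * k + 1)%N + g (3 * k + 2)%N).
Proof.
elim: n => [|n IHn]; first by rewrite !big_ord0.
by rewrite mulnS addnC addn3 !big_ord_recr /= IHn addn1 addn2 -!addrA.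
Qed.

Lemma psi_3n (n : nat) :
  psi (3 * n) = (n == 0%N)%:R
    + \sum_(k < n) ((k * k.+1 + tri k.+1 == n)%N%:R
                    + (k.+1 * k.+1 + tri k.+1 == n)%N%:R).
Proof.
(* Setting the index 0 aside groups the others as [3k+1], [3k+2], [3k+3]; the last two give one
   pentagonal pair. *)
rewrite -(psi_stable (ltnSn _)) big_ord_recl /=; congr (_ + _).
  by congr (_%:R); congr nat_of_bool; rewrite /tri; lia.
rewrite (big_ord_mod3 n (fun t => (tri t.+1 == 3 * n)%N%:R)).
apply: eq_bigr => k _.
have [-> -> ->] : [/\ (3 * k).+1 = 3 * k + 1, (3 * k + 1).+1 = 3 * k + 2
                    & (3 * k + 2).+1 = 3 * k.+1]%N by split; lia.
rewrite tri_3k1 tri_3k2 tri_3k !eqn_pmul2l //.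
have -> : (9 * tri k + 1 == 3 * n)%N = false by lia.
by rewrite add0r.
Qed.

Lemma psi_3n2 n : psi (3 * n + 2) = 0.
Proof.
have lt3 : (3 * n + 2 < 3 * n.+1)%N by lia.
rewrite -(psi_stable lt3) (big_ord_mod3 _ (fun t => (tri t == _)%:R)).
rewrite big1 // => k _; rewrite tri_3k tri_3k1 tri_3k2.
have [-> -> ->] : [/\ (3 * (k * k + tri k) == 3 * n + 2) = false,
    (9 * tri k + 1 == 3 * n + 2) = false
  & (3 * (k * k.+1 + tri k.+1) == 3 * n + 2) = false]%N by split; lia.
by rewrite !addr0.
Qed.

Lemma psi_9n1 n : psi (9 * n + 1) = psi n.
Proof.
have lt9 : (9 * n + 1 < 3 * (3 * n).+1)%N by lia.
have lt3 : (n < (3 * n).+1)%N by lia.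
rewrite -(psi_stable lt9) (big_ord_mod3 _ (fun t => (tri t == _)%:R)).
rewrite -(psi_stable lt3); apply: eq_bigr => k _.
rewrite tri_3k tri_3k1 tri_3k2.
have [-> -> ->] : [/\ (3 * (k * k + tri k) == 9 * n + 1) = false,
    (9 * tri k + 1 == 9 * n + 1) = (tri k == n)
  & (3 * (k * k.+1 + tri k.+1) == 9 * n + 1) = false]%N by split; lia.
by rewrite add0r addr0.
Qed.

(** * Theta and eta quotients *)

Section ThetaQuotient.

Variables (R : comNzRingType) (M : nat).

Local Notation F := (euler_poly R M).

Definition psi_poly k : {poly R} := \sum_(s < M.*2.+1) (- 'X^k) ^+ tri s.

Lemma exprNXn k e : (- 'X^k : {poly R}) ^+ e = (-1) ^+ e * 'X^(k * e).
Proof. by rewrite [LHS]exprNn -exprM. Qed.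

(** In [gauss_finite] at [-X^k] the terms with [s > 0] have order above [M], and the even powers in
    the term [s = 0] absorb the sign. *)
Lemma psi_poly_odd k : (0 < k)%N ->
  eqX M.+1 (prod_odd (- 'X^k) M * psi_poly k) (F (2 * k)).
Proof.
move=> k_gt0; rewrite gauss_finite.
under eq_bigr do rewrite exprNXn mulrA.
pose G s := prod_even (- 'X^k : {poly R}) s M * prod_odd (- 'X^k) s
              * (-1) ^+ (s * M.*2.+1).
have e_ge s : (0 < s -> M < k * (s * M.*2.+1))%N by nia.
apply: eqX_trans (eqX_sum_first M G e_ge) _.
suff <- : prod_even (- 'X^k) 0 M = F (2 * k).
  by rewrite /G /prod_odd big_ord0 mul0n muln0 !expr0 !mulr1.
rewrite /euler_poly /prod_even big_add1 /=; apply: eq_bigr => j _.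
by rewrite exprNXn -signr_odd odd_double mul1r -mul2n mulnCA mulnA.
Qed.

Lemma prod_odd_euler k : (0 < k)%N ->
  eqX M.+1 (prod_odd 'X^k M * F (2 * k)) (F k).
Proof.
move=> k_gt0.
have := prod_odd_even ('X^k : {poly R}) M.
have -> : \prod_(1 <= i < M.+1) (1 - 'X^k ^+ i.*2) = F (2 * k).
  by apply: eq_bigr => i _; rewrite -exprM -mul2n mulnCA mulnA.
move->.
have -> : \prod_(1 <= i < M.*2.+1) (1 - 'X^k ^+ i)
    = \prod_(1 <= i < M.*2.+1) (1 - 'X^(k * i)) :> {poly R}.
  by apply: eq_bigr => i _; rewrite -exprM.
by apply: eqX_prod_trunc; rewrite // -addnn leq_addr.
Qed.

Lemma prod_oddN k :
  prod_odd 'X^k M * prod_odd (- 'X^k) M = prod_odd ('X^(2 * k) : {poly R}) M.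
Proof.
rewrite /prod_odd -big_split /=; apply: eq_bigr => i _.
rewrite exprNXn -signr_odd /= odd_double -!exprM -mulnA [(2 * _)%N]mulnC.
by rewrite [in RHS]exprM; ring.
Qed.

(** Modulo [X^(M+1)], [F (2k) = O G F (4k)], [G psi_poly k = F (2k)] and [O F (2k) = F k];
    substituting in this order needs no division. *)
Lemma psi_poly_euler k : (0 < k)%N ->
  eqX M.+1 (psi_poly k * F (2 * k)) (F k * F (4 * k)).
Proof.
move=> k_gt0; have k2_gt0 : (0 < 2 * k)%N by rewrite muln_gt0.
pose O : {poly R} := prod_odd 'X^k M; pose G : {poly R} := prod_odd (- 'X^k) M.
have FO := prod_odd_euler k_gt0; rewrite -/O in FO.
have PG := psi_poly_odd k_gt0; rewrite -/G in PG.
have := prod_odd_euler k2_gt0; rewrite -prod_oddN -/O -/G mulnA => FOG.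
apply: eqX_trans (eqXM (eqX_refl (psi_poly k)) (eqX_sym FOG)) _.
have -> : psi_poly k * (O * G * F (2 * 2 * k))
    = G * psi_poly k * (O * F (4 * k)) by ring.
apply: eqX_trans (eqXM PG (eqX_refl _)) _.
have -> : F (2 * k) * (O * F (4 * k)) = O * F (2 * k) * F (4 * k) by ring.
exact: eqXM.
Qed.

(** Coefficients are sent to [R]: [int] serves the exact identity, ['F_2] the congruences. *)
Definition trunc (a : fps) : {poly R} := \poly_(i < M.+1) (a i)%:~R.

Lemma trunc_mul a b : eqX M.+1 (trunc (a * b)%fps) (trunc a * trunc b).
Proof.
move=> i lt_iM; rewrite coef_poly lt_iM coefM rmorph_sum /=.
apply: eq_bigr => j _; rewrite rmorphM !coef_poly.
by rewrite !(leq_ltn_trans _ lt_iM) // ?leq_subr // -ltnS.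
Qed.

Lemma trunc_exp a k : eqX M.+1 (trunc (a ^+ k)%fps) (trunc a ^+ k).
Proof.
elim: k => [|k IHk].
  by move=> i lt_iM; rewrite coef_poly lt_iM coef1 /fps_exp /= rmorph_nat.
by rewrite exprS; apply: eqX_trans (trunc_mul _ _) _; apply: eqXM.
Qed.

Lemma trunc_euler j : (0 < j)%N -> eqX M.+1 (trunc (euler_f j)) (F j).
Proof.
move=> j_gt0 i lt_iM; rewrite coef_poly lt_iM.
have <- : map_poly intr (euler_poly int M j) = F j.
  rewrite rmorph_prod /=; apply: eq_bigr => k _.
  by rewrite rmorphB /= rmorph1 map_polyXn.
by rewrite coef_map /= euler_f_stable.
Qed.

Lemma coef_exprNXn k e i :
  ((- 'X^k : {poly R}) ^+ e)`_i = (-1) ^+ e * (i == (k * e)%N)%:R.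
Proof.
rewrite exprNXn; have -> : (-1) ^+ e = ((-1) ^+ e)%:P :> {poly R}.
  by rewrite rmorphXn rmorphN1.
by rewrite coefCM coefXn.
Qed.

Lemma trunc_psi k : (0 < k)%N ->
  eqX M.+1 (trunc (fps_subst psi (-1) k)) (psi_poly k).
Proof.
move=> k_gt0 i lt_iM; rewrite coef_poly lt_iM coef_sum /fps_subst.
under eq_bigr do rewrite coef_exprNXn.
case: ifPn => [/dvdnP[j def_i] | ndvd_ki]; last first.
  rewrite big1 // => s _; case: eqP => [def_i|]; last by rewrite mulr0.
  by rewrite def_i dvdn_mulr in ndvd_ki.
rewrite def_i mulnK // rmorphM rmorphXn rmorphN1 /=.
have lt_jM : (j < M.*2.+1)%N by nia.
rewrite -(psi_stable lt_jM) rmorph_sum mulr_sumr; apply: eq_bigr => s _.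
rewrite mulnC eqn_pmul2l // eq_sym rmorph_nat.
(* The signs agree because a nonzero term has [tri s = j]. *)
by case: eqP => [->|]; rewrite ?mulr0.
Qed.

Lemma trunc_ext a b : a =1 b -> trunc a = trunc b.
Proof.
by move=> eq_ab; apply/polyP=> i; rewrite !coef_poly eq_ab.
Qed.

(** Trade [F 1 * F 4] for [psi(-q) F 2], apply the defining relation of [pod2], then use
    [psi(-q^2) F 4 = F 2 * F 8]. *)
Lemma trunc_pod2 :
  eqX M.+1 (trunc pod2 * (F 1 * F 4 ^+ 2)) (F 2 ^+ 2 * F 8).
Proof.
have P1 := @psi_poly_euler 1 isT; have P2 := @psi_poly_euler 2 isT.
have p_psi : eqX M.+1 (trunc pod2 * psi_poly 1) (psi_poly 2).
  apply: eqX_trans (trunc_psi (isT : 0 < 2)%N); rewrite -(trunc_ext pod2_spec).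
  apply: eqX_trans (eqX_sym (trunc_mul _ _)).
  exact/eqXM/eqX_sym/trunc_psi.
have -> : trunc pod2 * (F 1 * F 4 ^+ 2) = F 1 * F 4 * (trunc pod2 * F 4) by ring.
apply: eqX_trans (eqXM (eqX_sym P1) (eqX_refl _)) _.
have -> : psi_poly 1 * F 2 * (trunc pod2 * F 4)
    = trunc pod2 * psi_poly 1 * (F 2 * F 4) by ring.
apply: eqX_trans (eqXM p_psi (eqX_refl _)) _.
have -> : psi_poly 2 * (F 2 * F 4) = psi_poly 2 * F 4 * F 2 by ring.
apply: eqX_trans (eqXM P2 (eqX_refl _)) _.
by have -> : F 2 * F 8 * F 2 = F 2 ^+ 2 * F 8 by ring.
Qed.

End ThetaQuotient.

(** * From truncations back to power series: the eta quotient *)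

Lemma fps_mulIr (a b d : fps) : d 0%N = 1 -> (a * d =1 b * d)%fps -> a =1 b.
Proof.
move=> d0 eq_ab n.
have: eqX n.+1 (trunc int n a) (trunc int n b).
  apply: (@eqX_cancel _ _ (trunc int n d)); first by rewrite coef_poly d0.
  apply: eqX_trans (eqX_sym (trunc_mul _ _ _)) _; rewrite (trunc_ext _ _ eq_ab).
  exact: trunc_mul.
by move/(_ n (ltnSn n)); rewrite !coef_poly ltnSn !intz.
Qed.

Lemma pod2_eta :
  (pod2 =1 (euler_f 2 ^+ 2 * euler_f 8) / (euler_f 1 * euler_f 4 ^+ 2))%fps.
Proof.
apply: (fps_mulIr eta_denominator0) => n.
rewrite fps_divK ?eta_denominator0 //.
have E j : (0 < j)%N -> _ := @trunc_euler int n j.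
have E2 j : (0 < j)%N ->
    eqX n.+1 (trunc int n (euler_f j ^+ 2)%fps) (euler_poly int n j ^+ 2).
  move=> j_gt0; apply: eqX_trans (trunc_exp _ _ _) _.
  by rewrite !expr2; apply: eqXM; apply: E.
have num : eqX n.+1 (trunc int n (euler_f 2 ^+ 2 * euler_f 8)%fps)
                    (euler_poly int n 2 ^+ 2 * euler_poly int n 8).
  by apply: eqX_trans (trunc_mul _ _ _) _; apply: eqXM; [apply: E2 | apply: E].
have den : eqX n.+1 (trunc int n (euler_f 1 * euler_f 4 ^+ 2)%fps)
                    (euler_poly int n 1 * euler_poly int n 4 ^+ 2).
  by apply: eqX_trans (trunc_mul _ _ _) _; apply: eqXM; [apply: E | apply: E2].
have: eqX n.+1 (trunc int n (pod2 * (euler_f 1 * euler_f 4 ^+ 2))%fps)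
               (trunc int n (euler_f 2 ^+ 2 * euler_f 8)%fps).
  apply: eqX_trans (eqX_sym num); apply: eqX_trans (@trunc_pod2 _ _).
  by apply: eqX_trans (trunc_mul _ _ _) _; apply: eqXM.
by move/(_ n (ltnSn n)); rewrite !coef_poly ltnSn !intz.
Qed.

(** * Reduction modulo 2 *)

Lemma eqz_mod2 (a b : int) :
  a%:~R = b%:~R :> 'F_2 -> (a = b %[mod 2])%Z.
Proof.
move=> eq_ab; apply/eqP; rewrite eqz_mod_dvd.
by rewrite (dvdz_pcharf (pchar_Fp (isT : prime 2))) rmorphB /= eq_ab subrr.
Qed.

Lemma oppr_F2 (x : 'F_2) : - x = x.
Proof. exact/oppr_pchar2/pchar_Fp. Qed.

(** Frobenius in characteristic 2, applied factor by factor. *)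
Lemma euler_poly_sqr M j :
  euler_poly 'F_2 M (2 * j) = euler_poly 'F_2 M j ^+ 2.
Proof.
have char2 : 2 \in [pchar {poly 'F_2}].
  exact/(rmorph_pchar (@polyC 'F_2))/pchar_Fp.
rewrite /euler_poly -prodrXl; apply: eq_bigr => k _.
rewrite !(oppr_pchar2 char2) sqrrD expr1n mul1r mulr2n (addrr_pchar2 char2).
by rewrite addr0 -exprM -mulnA mulnC.
Qed.

Section EulerMod2.

Variable M : nat.

Local Notation f1 := (euler_poly 'F_2 M 1).

Lemma euler2_mod2 : euler_poly 'F_2 M 2 = f1 ^+ 2.
Proof. exact: (euler_poly_sqr M 1). Qed.

Lemma euler4_mod2 : euler_poly 'F_2 M 4 = f1 ^+ 4.
Proof. by rewrite (euler_poly_sqr M 2) euler2_mod2 -exprM. Qed.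

Lemma euler8_mod2 : euler_poly 'F_2 M 8 = f1 ^+ 8.
Proof. by rewrite (euler_poly_sqr M 4) euler4_mod2 -exprM. Qed.

Lemma euler1X_coef0 k : (f1 ^+ k)`_0 = 1.
Proof. by rewrite -horner_coef0 horner_exp horner_coef0 euler_poly_coef0 ?expr1n. Qed.

Lemma psi_poly_cube : eqX M.+1 (psi_poly 'F_2 M 1) (f1 ^+ 3).
Proof.
apply: (@eqX_cancel _ _ (f1 ^+ 2)); first exact: euler1X_coef0.
have := @psi_poly_euler 'F_2 M 1 isT; rewrite euler2_mod2 euler4_mod2.
by have -> : f1 ^+ 3 * f1 ^+ 2 = f1 * f1 ^+ 4 by ring.
Qed.

(** The eta quotient becomes [pod2 * f1^9 = f1^12], and [f1^9] cancels. *)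
Lemma trunc_pod2_cube : eqX M.+1 (trunc 'F_2 M pod2) (f1 ^+ 3).
Proof.
apply: (@eqX_cancel _ _ (f1 ^+ 9)); first exact: euler1X_coef0.
have := @trunc_pod2 'F_2 M; rewrite euler2_mod2 euler4_mod2 euler8_mod2.
have -> : f1 * f1 ^+ 4 ^+ 2 = f1 ^+ 9 by ring.
by have -> : f1 ^+ 3 * f1 ^+ 9 = f1 ^+ 2 ^+ 2 * f1 ^+ 8 by ring.
Qed.

End EulerMod2.

Lemma psi_cube_mod2 n : (psi n)%:~R = (euler_poly 'F_2 n 1 ^+ 3)`_n.
Proof.
rewrite -(@psi_poly_cube n _ (ltnSn n)) -(@trunc_psi _ _ 1 isT _ (ltnSn n)) coef_poly ltnSn.
rewrite /fps_subst dvd1n divn1 rmorphM rmorphXn rmorphN1 /=.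
by rewrite oppr_F2 expr1n mul1r.
Qed.

Lemma pod2_psi_mod2 n : (pod2 n)%:~R = (psi n)%:~R :> 'F_2.
Proof.
by rewrite psi_cube_mod2 -(@trunc_pod2_cube n _ (ltnSn n)) coef_poly ltnSn.
Qed.

Lemma euler_cube_mod2 n : ((euler_f 1 ^+ 3)%fps n)%:~R = (psi n)%:~R :> 'F_2.
Proof.
rewrite psi_cube_mod2.
have E : eqX n.+1 (trunc 'F_2 n (euler_f 1)) (euler_poly 'F_2 n 1).
  exact: trunc_euler.
have: eqX n.+1 (trunc 'F_2 n (euler_f 1 ^+ 3)%fps) (euler_poly 'F_2 n 1 ^+ 3).
  by apply: eqX_trans (trunc_exp _ _ _) _; rewrite !exprS; do !apply: eqXM.
by move/(_ n (ltnSn n)); rewrite coef_poly ltnSn.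
Qed.

Lemma euler_psi_3n_mod2 n : (euler_f 1 n)%:~R = (psi (3 * n))%:~R :> 'F_2.
Proof.
have <- : (euler_poly 'F_2 n 1)`_n = (euler_f 1 n)%:~R.
  by rewrite -(@trunc_euler _ _ 1 isT _ (ltnSn n)) coef_poly ltnSn.
pose G s : {poly 'F_2} := (-1) ^+ s * prod_all 'X s n.
(* Hence only [s = 0] survives on the left of [pentagonal_finite], and that term is [f_1] up to
   degree [n]. *)
have e_ge s : (0 < s -> n < n * s + tri s)%N by have := leq_tri s; nia.
have <- : G 0%N * 'X^(n * 0 + tri 0) = euler_poly 'F_2 n 1.
  rewrite /G muln0 !mulr1 mul1r /prod_all /euler_poly big_add1.
  by apply: eq_bigr => k _; rewrite mul1n.
rewrite -(eqX_sum_first n G e_ge (ltnSn n)) pentagonal_finite psi_3n.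
rewrite coefD coef1 coef_sum rmorphD rmorph_nat rmorph_sum /=; congr (_ + _).
(* Modulo 2 the pentagonal signs disappear, leaving the indicator sum of [psi_3n]. *)
have opp1 : (-1 : {poly 'F_2}) = 1 by rewrite -polyCN oppr_F2.
apply: eq_bigr => k _; rewrite opp1 expr1n mul1r coefD !coefXn rmorphD !rmorph_nat.
by rewrite ![n == _]eq_sym.
Qed.

Theorem theorem1p1 :
  (pod2 =1 (euler_f 2 ^+ 2 * euler_f 8) / (euler_f 1 * euler_f 4 ^+ 2))%fps /\
  (forall n : nat, (0 < n)%N -> (pod2 (3 * n + 2)%N = 0 %[mod 2])%Z) /\
  fps_eqmod 2 (fun n => pod2 (3 * n)%N) (euler_f 1) /\
  fps_eqmod 2 (fun n => pod2 (9 * n + 1)%N) (euler_f 1 ^+ 3)%fps.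
Proof.
split; first exact: pod2_eta.
split=> [n _|]; last split=> n; apply: eqz_mod2; rewrite pod2_psi_mod2.
- by rewrite psi_3n2.
- by rewrite euler_psi_3n_mod2.
- by rewrite psi_9n1 euler_cube_mod2.
Qed.
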